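(* For an integer $n>2$, the dihedral group $D_{2n}=\langle x,y \mid x^n=y^2=1,\ xy=yx^{-1}\rangle$ of order $2n$ is filled if and only if it is one of $D_6, D_8, D_{10}, D_{12}, D_{14}, D_{22}$ (i.e. if and only if $n\in\{3,4,5,6,7,11\}$).
   Context: Let $G$ be a finite group and $S$ a non-empty subset of $G$. Write $SS=\{st : s,t\in S\}$ (with $s=t$ allowed) and $G^*=G\setminus\{1\}$. The set $S$ is product-free if $S\cap SS=\varnothing$. A product-free set $S$ in $G$ is locally maximal if whenever $T$ is product-free in $G$ and $S\subseteq T$, then $S=T$. A product-free set $S$ fills $G$ if $G^*\subseteq S\cup SS$. The group $G$ is filled if every locally maximal product-free set in $G$ fills $G$. Dihedral groups are indexed by their order: $D_{2n}$ has order $2n$, with $n>2$. *)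

(* Defs.v *)
From mathcomp Require Import all_boot all_fingroup all_solvable.

Set Implicit Arguments.
Unset Strict Implicit.
Unset Printing Implicit Defensive.

Local Open Scope group_scope.

Section Filled.

Variable gT : finGroupType.
Implicit Types (G : {group gT}) (S T : {set gT}).

Definition product_free G S : bool :=
  [&& S \subset G, S != set0 & S :&: (S * S) == set0].

Definition locally_maximal G S : Prop :=
  product_free G S /\ (forall T, product_free G T -> S \subset T -> S = T).

Definition fills G S : bool := G^# \subset S :|: (S * S).

Definition filled G : Prop := forall S, locally_maximal G S -> fills G S.

End Filled.

(* The library's presentation, with the relation x ^ y = x^-1 written out.    *)
Lemma Grp_dihedral_comm n : 2 < n ->
  'D_n.*2 \isog Grp (x : y : x ^+ n, y ^+ 2, x * y = y * x^-1).
Proof.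
move=> n_gt2 gT G; rewrite (Grp_dihedral (ltnW n_gt2)).
apply: eq_existsb => [[x y]] /=; rewrite !xpair_eqE.
by rewrite -(inj_eq (mulgI y) (x ^ y)) -conjgC.
Qed.

(* Main.v *)
Require Import Defs.
From mathcomp Require Import all_boot all_fingroup all_solvable.
From mathcomp Require Import zify.

(** A product-free set S of G is locally maximal exactly when each element g of
    G outside S and different from 1 is blocked by S: adjoining g to S creates
    a product inside the enlarged set, which means that one of g a, a g, g g
    lies in S, or that g = a b, for some a, b in S ([locally_maximalP]). Only
    the last kind of obstruction puts g into SS, so S fails to fill G when some
    g is blocked by the other kinds alone.

    In D_2n write x^i for the rotations and x^i y for the reflections, with i
    modulo n; S becomes a pair (A, B) of sets of residues, A for the rotations
    and B for the reflections. A reflection squares to 1 and inverts every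
    rotation, so for it being blocked amounts to lying in SS. Hence an element
    other than 1 missed by S and SS, for S locally maximal, is a rotation, and
    it is a quotient of two rotations of S or a square root of one.

    If n is 8, 10, or at least 12, put m = n./2 and h = uphalf m, and take
    A = [h, m - 1] and B = {0, m, n - m} ([band]). The differences of elements
    of A are the residues within m - 1 - h of 0, their sums are 2h, ..., 2m - 2,
    and the differences of elements of B are 0, m, n - m and, up to sign,
    n - 2m, which is 0 or 1 according to the parity of n. Together with A this
    leaves out no residue when m is even, and only h - 1 when m is odd; the
    latter is half of the element m - 1 of A. The translates of B by 0, A and
    - A cover all residues, so the reflections are blocked as well and the set
    is locally maximal. Yet the residue 1 (n even) or 2 (n odd) is a difference
    of elements of A, but neither an element of A, nor a sum of two of them, nor a
    difference of elements of B. For n = 9 the pair A = {2, 5}, B = {0, 1}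
    does the same and misses 3.

    In the other direction n is one of 3, 4, 5, 6, 7, 11, and a complete list of
    the product-free sets, built by adjoining unblocked elements one at a time,
    has about ten thousand entries for n = 11, which are checked by computation
    ([independent_subseqs_complete], [filled_dihedral_small]). *)

Set Implicit Arguments.
Unset Strict Implicit.
Unset Printing Implicit Defensive.

Local Open Scope group_scope.

(** * Locally maximal product-free sets *)

Section LocallyMaximal.

Variable gT : finGroupType.
Implicit Types (G : {group gT}) (S T : {set gT}).

Lemma product_freeP G S :
  reflect [/\ S \subset G, S != set0 & {in S &, forall a b, a * b \notin S}]
          (product_free G S).
Proof.
apply: (iffP and3P) => -[SG S0 SS]; split=> //.
  move=> a b Sa Sb; apply/negP=> Sab.
  by have /setP/(_ (a * b)) := eqP SS; rewrite !inE Sab mem_mulg.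
apply/eqP/setP=> g; rewrite !inE; apply/negP=> /andP[Sg /mulsgP[a b Sa Sb gE]].
by have := SS a b Sa Sb; rewrite -gE Sg.
Qed.

(** This is membership in the union of SS, of the quotients S S^-1 and S^-1 S
    and of the square roots of S. It is spelt with products only, so that it
    can be evaluated in coordinates without computing inverses. *)
Definition blocked S g :=
  [exists a in S, [|| g * a \in S, a * g \in S
                    | [exists b in S, a * b == g]]] || (g * g \in S).

(** The element 1 needs a separate clause: it never lies in a product-free set,
    as 1 * 1 = 1, whether or not it is blocked. *)
Lemma locally_maximalP G S :
  locally_maximal G S <->
  product_free G S /\ {in G, forall g, [|| g == 1, g \in S | blocked S g]}.
Proof.
split=> -[pfS maxS]; split=> //; have [SG S0 SS] := product_freeP _ _ pfS.
  move=> g Gg; apply/norP=> -[g1 /norP[S'g /norP[bg S'gg]]].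
  have nb a : a \in S ->
      [/\ g * a \notin S, a * g \notin S & {in S, forall b, a * b != g}].
    move=> Sa; move/exists_inPn: bg => /(_ a Sa)/norP[Sga /norP[Sag bg]].
    by split=> // b Sb; move/exists_inPn: bg; apply.
  have S'1 : 1 \notin S.
    by apply/negP=> S1; have := SS 1 1 S1 S1; rewrite mulg1 S1.
  suffices /maxS/(_ (subsetUr _ _))/setP/(_ g) : product_free G (g |: S).
    by rewrite !inE eqxx (negPf S'g).
  apply/product_freeP; split; first by rewrite subUset sub1set Gg.
    by apply/set0Pn; exists g; rewrite !inE eqxx.
  have mulg_idr (h k : gT) : (h * k == h) = (k == 1).
    by rewrite -{2}(mulg1 h) (inj_eq (mulgI h)).
  have mulg_idl (h k : gT) : (h * k == k) = (h == 1).
    by rewrite -{2}(mul1g k) (inj_eq (mulIg k)).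
  move=> a b; rewrite !inE => /predU1P[->|Sa] /predU1P[->|Sb]; apply/norP.
  - by rewrite mulg_idr.
  - have [-> _ _] := nb b Sb; rewrite mulg_idr; split=> //.
    by apply: contraNneq S'1 => <-.
  - have [_ -> _] := nb a Sa; rewrite mulg_idl; split=> //.
    by apply: contraNneq S'1 => <-.
  - by have [_ _ /(_ b Sb)->] := nb a Sa; rewrite SS.
move=> T pfT sST; have [TG _ TT] := product_freeP _ _ pfT.
apply/eqP; rewrite eqEsubset sST; apply/subsetP=> g Tg.
have {maxS} := maxS g (subsetP TG g Tg).
case/or3P=> [/eqP g1|//|].
  by have := TT g g Tg Tg; rewrite g1 mulg1 -g1 Tg.
have sub a : a \in S -> a \in T by apply: (subsetP sST).
case/orP=> [/exists_inP[a /sub Ta]|/sub]; last by rewrite (negPf (TT _ _ _ _)).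
case/or3P=> [/sub|/sub|/exists_inP[b /sub Tb /eqP gE]].
- by rewrite (negPf (TT _ _ _ _)).
- by rewrite (negPf (TT _ _ _ _)).
- by have := TT a b Ta Tb; rewrite gE Tg.
Qed.

End LocallyMaximal.

(** * Coordinates on the dihedral group *)

Section Coordinates.

Variable n : nat.
Implicit Types (c d : nat * bool) (s cs : seq (nat * bool)).

(** The pair (i, b) stands for x^i y^b. *)
Definition codes : seq (nat * bool) :=
  [seq (i, b) | b <- [:: false; true], i <- iota 0 n].

(** For b = true this is y x^j = x^(n - j) y; the second exponent is added
    modulo 2. *)
Definition code_mul c d : nat * bool :=
  ((if c.2 then c.1 + (n - d.1) else c.1 + d.1) %% n, c.2 (+) d.2).

Lemma mem_codes c : (c \in codes) = (c.1 < n).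
Proof.
case: c => i b; apply/allpairsP/idP=> [[[b' j] /= [_ + [-> _]]]|lt_in].
  by rewrite mem_iota.
by exists (b, i); rewrite /= mem_iota; case: b lt_in.
Qed.

Definition code_independent s :=
  all (fun a => all (fun b => code_mul a b \notin s) s) s.

Definition code_blocked s c :=
  has (fun a => [|| code_mul c a \in s, code_mul a c \in s
                  | has (fun b => code_mul a b == c) s]) s
  || (code_mul c c \in s).

Definition code_saturated s :=
  all (fun c => [|| c == (0, false), c \in s | code_blocked s c]) codes.

Definition code_filling s :=
  all (fun c => [|| c == (0, false), c \in s
                  | has (fun a => has (fun b => code_mul a b == c) s) s]) codes.

(** Testing only whether the new entry is blocked keeps the enumeration cheap;
    completeness is all that is asked of it. *)
Fixpoint independent_subseqs cs : seq (seq (nat * bool)) :=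
  if cs is c :: cs' then
    let ss := independent_subseqs cs' in
    [seq c :: s | s <- ss & ~~ code_blocked s c] ++ ss
  else [:: [::]].

(** Every way in which c can be blocked by s exhibits a product of two entries
    of c :: s that is an entry again. *)
Lemma code_independent_cons c s :
  code_independent (c :: s) -> code_independent s && ~~ code_blocked s c.
Proof.
move=> /allP ind; have {}ind a b : a \in c :: s -> b \in c :: s ->
    code_mul a b != c /\ code_mul a b \notin s.
  by move=> /ind/allP/[apply]; rewrite inE negb_or => /andP.
have sc : c \in c :: s by rewrite mem_head.
have ss a : a \in s -> a \in c :: s by rewrite inE orbC => ->.
apply/andP; split.
  by apply/allP=> a /ss a_s; apply/allP=> b /ss b_s; case: (ind a b a_s b_s).
rewrite negb_or (ind c c sc sc).2 andbT; apply/hasPn=> a /ss a_s.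
rewrite !negb_or (ind c a _ _).2 ?(ind a c _ _).2 //=.
by apply/hasPn=> b /ss b_s; case: (ind a b a_s b_s).
Qed.

Lemma independent_subseqs_complete (P : pred (nat * bool)) cs :
  code_independent (filter P cs) -> filter P cs \in independent_subseqs cs.
Proof.
elim: cs => //= c cs IHcs; case: ifP => [_ /code_independent_cons/andP[]|_].
  move=> /IHcs mem_s nb; rewrite mem_cat; apply/orP; left.
  by apply/mapP; exists (filter P cs); rewrite // mem_filter nb.
by move/IHcs; rewrite mem_cat orbC => ->.
Qed.

End Coordinates.

(** The words x^i y^b cover the group because <[x]> is normalised by y. There
    are at most 2n of them, which is the order of the group, so they are
    pairwise distinct. *)
Lemma dihedral_coordinates n : 2 < n ->
  exists e : nat * bool -> 'D_n.*2,
    [/\ {in codes n &, injective e},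
        forall g, g \in 'D_n.*2 <-> exists2 c, c \in codes n & e c = g,
        {in codes n &, {morph e : c d / code_mul n c d >-> c * d}}
      & e (0, false) = 1].
Proof.
move=> n_gt2; have n_gt0 : 0 < n by lia.
case/(isoGrpP _ (Grp_dihedral (ltnW n_gt2))): (isog_refl 'D_n.*2) => _.
case/existsP=> -[x y] /= /eqP[defG xn y2 xy].
have {}defG : <[x]> * <[y]> = 'D_n.*2.
  by rewrite -defG norm_joinEr // norms_cycle xy groupV cycle_id.
have onto g : g \in 'D_n.*2 <->
    exists2 c, c \in codes n & x ^+ c.1 * y ^+ c.2 = g.
  split=> [|_]; last by rewrite inE.
  rewrite -{1}defG.
  case/mulsgP=> _ _ /cycleP[i ->] /cycleP[j ->] ->.
  exists (i %% n, odd j); first by rewrite mem_codes ltn_mod.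
  by rewrite /= expg_mod // -modn2 expg_mod.
exists (fun c : nat * bool => x ^+ c.1 * y ^+ c.2).
split=> //; last by rewrite mulg1.
  have U : uniq [seq x ^+ c.1 * y ^+ c.2 | c : nat * bool <- codes n].
    apply: leq_size_uniq (enum_uniq 'D_n.*2) _ _ => [g|].
      by rewrite mem_enum => /onto[c Cc <-]; apply: map_f.
    rewrite size_map size_allpairs size_iota -cardE mul2n.
    by rewrite card_dihedral // ltnW.
  move=> c d Cc Cd eq_cd; rewrite -(nth_index c Cc) -(nth_index c Cd).
  congr nth; apply/eqP; rewrite -(nth_uniq 1 _ _ U) ?size_map ?index_mem //.
  by rewrite !(nth_map c) ?index_mem // !nth_index // eq_cd.
move=> [i b] [j b']; rewrite !mem_codes /= => lt_in lt_jn; rewrite expg_mod //.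
have -> : y ^+ (b (+) b') = y ^+ b * y ^+ b'.
  by case: (b) (b') => -[]; rewrite /= ?expg0 ?mulg1 ?mul1g // -expgS y2.
case: b => /=; rewrite expgD; last by rewrite !mulgA expg0 !mulg1.
have -> : x ^+ j = (x ^+ (n - j)) ^ y.
  rewrite conjXg xy -[LHS]invgK -expgVn; apply/eqP.
  by rewrite eq_invg_mul -expgD subnKC ?expgVn ?xn ?invg1 // ltnW.
by rewrite expg1 -!mulgA; congr (_ * _); rewrite mulKVg.
Qed.

(** * Transfer between subsets and lists of coordinates *)

Section Transfer.

Variables (gT : finGroupType) (G : {group gT}) (n : nat).
Variable e : nat * bool -> gT.
Implicit Types (c d : nat * bool) (s : seq (nat * bool)).

Hypothesis n_gt0 : 0 < n.
Hypothesis e_inj : {in codes n &, injective e}.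
Hypothesis e_onto : forall g, g \in G <-> exists2 c, c \in codes n & e c = g.
Hypothesis eM : {in codes n &, {morph e : c d / code_mul n c d >-> c * d}}.
Hypothesis e1 : e (0, false) = 1.

Let mulC c d : code_mul n c d \in codes n.
Proof. by rewrite mem_codes ltn_mod. Qed.

Let oneC : (0, false) \in codes n. Proof. by rewrite mem_codes. Qed.

Section Image.

Variable s : seq (nat * bool).
Hypothesis sC : {subset s <= codes n}.

Let mem_e c : c \in codes n -> (e c \in [set:: map e s]) = (c \in s).
Proof.
move=> Cc; rewrite inE; apply/mapP/idP=> [[d sd /e_inj->]|sc] //; first exact: sC.
by exists c.
Qed.

Let exists_e (P : pred gT) : [exists a in [set:: map e s], P a] = has (P \o e) s.
Proof.
apply/exists_inP/hasP=> [[_ /[!inE] /mapP[c sc ->] Pc]|[c sc Pc]].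
  by exists c.
by exists (e c) => //; rewrite mem_e // sC.
Qed.

Let eq_e c d : c \in codes n -> d \in codes n -> (e c == e d) = (c == d).
Proof. by move=> Cc Cd; apply/eqP/eqP=> [/e_inj->|->]. Qed.

Lemma product_free_image :
  product_free G [set:: map e s] = (s != [::]) && code_independent n s.
Proof.
apply/product_freeP/andP=> [[_ S0 SS]|[s0 /allP ind]]; split.
- by apply: contraNneq S0 => ->; apply/eqP/setP=> g; rewrite !inE.
- apply/allP=> a sa; apply/allP=> b sb.
  by rewrite -mem_e // eM ?sC // SS // mem_e ?sC.
- by apply/subsetP=> _ /[!inE]/mapP[c sc ->]; apply/e_onto; exists c; rewrite ?sC.
- case: (s) s0 => // c s' _; apply/set0Pn; exists (e c).
  by rewrite inE mem_head.
- move=> _ _ /[!inE]/mapP[a sa ->]/mapP[b sb ->]; have /allP/(_ b sb) := ind a sa.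
  by rewrite -eM ?sC // -mem_e // inE.
Qed.

Let has_mul c : c \in codes n ->
  [exists a in [set:: map e s], [exists b in [set:: map e s], a * b == e c]]
  = has (fun a => has (fun b => code_mul n a b == c) s) s.
Proof.
move=> Cc; rewrite exists_e; apply: eq_in_has => a sa /=; rewrite exists_e.
by apply: eq_in_has => b sb /=; rewrite -eM ?sC // eq_e.
Qed.

Lemma blocked_image c : c \in codes n ->
  blocked [set:: map e s] (e c) = code_blocked n s c.
Proof.
move=> Cc; rewrite /blocked exists_e -eM // mem_e //; congr (_ || _).
apply: eq_in_has => a sa /=; have Ca := sC sa; rewrite -!eM // !mem_e // exists_e.
by congr [|| _, _ | _]; apply: eq_in_has => b sb /=; rewrite -eM ?sC // eq_e.
Qed.

Lemma locally_maximal_image :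
  locally_maximal G [set:: map e s] <->
  [&& s != [::], code_independent n s & code_saturated n s].
Proof.
rewrite andbA -product_free_image locally_maximalP.
have Ee c : c \in codes n ->
    [|| e c == 1, e c \in [set:: map e s] | blocked [set:: map e s] (e c)]
    = [|| c == (0, false), c \in s | code_blocked n s c].
  by move=> Cc; rewrite -e1 eq_e // mem_e // blocked_image.
split=> [[-> max]|/andP[-> /allP sat]] /=.
  by apply/allP=> c Cc; rewrite -Ee // max //; apply/e_onto; exists c.
by split=> // _ /e_onto[c Cc <-]; rewrite Ee // sat.
Qed.

Lemma fills_image : fills G [set:: map e s] = code_filling n s.
Proof.
have Ee c : c \in codes n ->
    [|| e c == 1, e c \in [set:: map e s]
      | e c \in [set:: map e s] * [set:: map e s]]
    = [|| c == (0, false), c \in s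
        | has (fun a => has (fun b => code_mul n a b == c) s) s].
  move=> Cc; rewrite -e1 eq_e // mem_e // -has_mul //; congr [|| _, _ | _].
  apply/mulsgP/exists_inP=> [[a b Sa Sb ->]|[a Sa /exists_inP[b Sb /eqP<-]]].
    by exists a => //; apply/exists_inP; exists b.
  by exists a b.
apply/subsetP/allP=> [fil c Cc|fil g].
  rewrite -Ee //; case: eqP => //= c1; rewrite -in_setU; apply: fil.
  by rewrite !inE (introN eqP c1); apply/e_onto; exists c.
rewrite !inE => /andP[g1 /e_onto[c Cc gE]].
by have := fil c Cc; rewrite -Ee // gE (negPf g1) !inE.
Qed.

End Image.

(** Only sublists of [codes n] in their given order need to be considered, which
    is the form in which product-free sets are enumerated. *)
Lemma filled_of_codes :
    (forall P, let s := filter P (codes n) in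
       code_independent n s -> code_saturated n s -> code_filling n s) ->
  filled G.
Proof.
move=> fil S maxS; have [/product_freeP[/subsetP SG _ _] _] := maxS.
pose s := [seq c <- codes n | e c \in S].
have sC : {subset s <= codes n} by apply/mem_subseq/filter_subseq.
have defS : S = [set:: map e s].
  apply/setP=> g; rewrite inE; apply/idP/mapP=> [Sg|[c + ->]].
    have /e_onto[c Cc gE] := SG g Sg.
    by exists c; rewrite // mem_filter gE Sg.
  by rewrite mem_filter => /andP[].
move: maxS; rewrite defS => /(locally_maximal_image sC)/and3P[_ ind sat].
by rewrite fills_image //; apply: fil.
Qed.

Lemma not_filled_of_codes s :
    {subset s <= codes n} -> s != [::] -> code_independent n s ->
    code_saturated n s -> ~~ code_filling n s ->
  ~ filled G.
Proof.
move=> sC s0 ind sat /negP unfilled filG; apply: unfilled.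
by rewrite -(fills_image sC); apply/filG/(locally_maximal_image sC)/and3P.
Qed.

End Transfer.

(** * The filled dihedral groups *)

Lemma filled_dihedral_small n : n \in [:: 3; 4; 5; 6; 7; 11] -> filled 'D_n.*2.
Proof.
move=> n_small.
have n_gt2 : 2 < n by move: n_small; rewrite !inE; lia.
have [e [e_inj e_onto eM e1]] := dihedral_coordinates n_gt2.
apply: (filled_of_codes _ e_inj e_onto eM e1) => [|P s ind]; first by lia.
have {ind} : s \in independent_subseqs n (codes n).
  exact: independent_subseqs_complete.
move: (s) => {P s}t t_ind; apply/implyP; move: t t_ind; apply/allP.
clear -n_small.
by move: n n_small; apply/allP; vm_compute.
Qed.

(** * The dihedral groups that are not filled *)

(** The rotation x^3 is blocked, being x^5 x^-2, but it is not in the set and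
    not a product of two elements of it. *)
Lemma not_filled_dihedral18 : ~ filled 'D_18.
Proof.
have [e [e_inj e_onto eM e1]] := @dihedral_coordinates 9 isT.
pose s := [:: (2, false); (5, false); (0, true); (1%N, true)].
apply: (not_filled_of_codes _ e_inj e_onto eM e1 (s := s)) => //.
by apply/allP.
Qed.

(** The reflections have exponents 0 and, up to rounding, n / 2, the rotations
    the exponents from n / 4 to n / 2. For even n the last two entries
    coincide, which is harmless as only membership matters. *)
Definition band n : seq (nat * bool) :=
  let m := n./2 in let h := uphalf m in
  [seq (i, false) | i <- iota h (m - h)]
    ++ [:: (0, true); (m, true); (n - m, true)].

Lemma mem_band n i b :
  ((i, b) \in band n) =
  if b then i \in [:: 0; n./2; n - n./2] else uphalf n./2 <= i < n./2.
Proof.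
have le_hm : uphalf n./2 <= n./2 by lia.
rewrite /band mem_cat; case: b.
  by rewrite orbC !inE !xpair_eqE !andbT; case: mapP => [[]|_] //; rewrite orbF.
rewrite !inE !xpair_eqE !andbF !orbF mem_map => [|j k []//].
by rewrite mem_iota subnKC.
Qed.

Lemma modn_cases z n : 0 < n -> z < n + n -> z %% n = z \/ z %% n + n = z.
Proof.
move=> n_gt0 lt_z2n; case: (ltnP z n) => [/modn_small|le_nz]; first by left.
right; rewrite -[in LHS](subnK le_nz) modnDr modn_small ?subnK //; lia.
Qed.

Section Band.

Variable n : nat.
(* In other words n >= 8 when n is even and n >= 13 when n is odd, which makes
   1 + odd n a difference of two exponents in [h, m - 1]. *)
Hypothesis n_large : (7 + 5 * odd n < n)%N.

Let m := n./2.
Let h := uphalf m.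

Let halves : [/\ n = (m + m + odd n)%N, h + h = (m + odd m)%N & 4 <= m].
Proof. rewrite /h /m; split; lia. Qed.

Let memB i b : ((i, b) \in band n) =
  if b then [|| i == 0, i == m | i == n - m] else h <= i < m.
Proof. by rewrite mem_band !inE. Qed.

Lemma band_codes : {subset band n <= codes n}.
Proof.
have [nE hE m_ge4] := halves; clearbody m h.
by move=> [i b]; rewrite memB mem_codes /=; case: b; lia.
Qed.

Lemma band_independent : code_independent n (band n).
Proof.
have [nE hE m_ge4] := halves; clearbody m h.
apply/allP=> -[i b] Si; apply/allP=> -[j b'] Sj.
rewrite memB in Si; rewrite memB in Sj; rewrite /code_mul /= memB.
have lt_i : i < n by case: (b) Si; lia.
have lt_j : j < n by case: (b') Sj; lia.
set z := if b then _ else _; have lt_z : z < n + n by rewrite /z; case: (b); lia.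
have n_gt0 : 0 < n by lia.
rewrite {}/z in lt_z *; case: (modn_cases n_gt0 lt_z) => {lt_z}.
all: by case: b b' Si Sj => -[] /=; lia.
Qed.

(** The reflections are covered by B and by the translates of A and - A by 0, m
    and n - m; the rotations are covered as explained at the top. *)
Lemma band_saturated : code_saturated n (band n).
Proof.
have [nE hE m_ge4] := halves; clearbody m h.
have mulE i b j b' k : k < n ->
    let z := if b then i + (n - j) else i + j in z = k \/ z = k + n ->
    code_mul n (i, b) (j, b') = (k, b (+) b').
  move=> lt_kn z zE; congr (_, _); rewrite -[LHS]/(z %% n).
  by case: zE => ->; rewrite ?modnDr modn_small.
have prod i b j b' k : (i, b) \in band n -> (j, b') \in band n -> k < n ->
    let z := if b then i + (n - j) else i + j in z = k \/ z = k + n ->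
    [|| (k, b (+) b') == (0, false), (k, b (+) b') \in band n
      | code_blocked n (band n) (k, b (+) b')].
  move=> Si Sj lt_kn z zE; have ij := mulE i b j b' k lt_kn zE.
  apply/or3P/Or33/orP; left; apply/hasP; exists (i, b) => //.
  by apply/or3P/Or33/hasP; exists (j, b'); rewrite // ij.
have quot i j k :
    h <= i < m -> h <= j < m -> k + i = j \/ k + i = j + n ->
    [|| (k, false) == (0, false), (k, false) \in band n
      | code_blocked n (band n) (k, false)].
  move=> Si Sj ijk; apply/or3P/Or33/orP; left; apply/hasP.
  exists (i, false); first by rewrite memB.
  by apply/or3P/Or31; rewrite (mulE _ _ _ _ j) ?memB //; lia.
apply/allP=> -[z b]; rewrite mem_codes /= => lt_zn; case: b.
  have [z_half|z_nhalf] := boolP [|| z == 0, z == m | z == n - m].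
    by rewrite memB z_half orbT.
  have [z1|z1] := leqP z (m - h).
    by apply: (prod m true (m - z) false); rewrite ?memB; lia.
  have [z2|z2] := ltnP z m.
    by apply: (prod z false 0 true); rewrite ?memB; lia.
  have [z3|z3] := leqP z (n - h).
    by apply: (prod 0 true (n - z) false); rewrite ?memB; lia.
  by apply: (prod (z - (n - m)) false (n - m) true); rewrite ?memB; lia.
have [->|z_neq0] := eqVneq z 0; first by rewrite eqxx.
have [z_small|z_ge] := ltnP (z + h) m; first by apply: (quot h (z + h)); lia.
have [z_large|z_le] := ltnP n (z + (m - h)).
  by apply: (quot (h + (n - z)) h); lia.
have [z_band|z_nband] := boolP (h <= z < m); first by rewrite memB z_band orbT.
have [z_mid|z_low] := leqP h z; last first.
  (* Here z = h - 1 and m is odd, so z + z = m - 1. *)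
  apply/or3P/Or33/orP; right.
  by rewrite (mulE _ _ _ _ (z + z)) ?memB /=; lia.
have [z_half|z_nhalf] := boolP ((z == m) || (z == n - m)).
  by apply: (prod z true 0 true); rewrite ?memB; lia.
(* The smaller summand is h unless the other one would then exceed m - 1. *)
pose i := maxn h (z - m.-1).
by apply: (prod i false (z - i) false); rewrite ?memB; lia.
Qed.

Lemma band_unfilling : ~~ code_filling n (band n).
Proof.
have [nE hE m_ge4] := halves; clearbody m h.
apply/allPn; exists ((odd n).+1, false); first by rewrite mem_codes /=; lia.
rewrite memB !negb_or xpair_eqE andbT /=; apply/andP; split; first lia.
apply/hasPn=> -[i b] Si; apply/hasPn=> -[j b'] Sj.
rewrite memB in Si; rewrite memB in Sj; rewrite /code_mul xpair_eqE /=.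
have lt_i : i < n by case: (b) Si; lia.
have lt_j : j < n by case: (b') Sj; lia.
set z := if b then _ else _; have lt_z : z < n + n by rewrite /z; case: (b); lia.
have n_gt0 : 0 < n by lia.
rewrite {}/z in lt_z *; case: (modn_cases n_gt0 lt_z) => {lt_z}.
all: by case: b b' Si Sj => -[] /=; lia.
Qed.

End Band.

Theorem theorem2p5 (n : nat) (n_gt2 : 2 < n) :
  filled ('D_n.*2)%G <-> n \in [:: 3; 4; 5; 6; 7; 11].
Proof.
split=> [filD|]; last exact: filled_dihedral_small.
apply: contraPT filD => n_big.
have [n9|n_neq9] := eqVneq n 9; first by rewrite n9; apply: not_filled_dihedral18.
have n_large : (7 + 5 * odd n < n)%N by move: n_big; rewrite !inE; lia.
have [e [e_inj e_onto eM e1]] := dihedral_coordinates n_gt2.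
have n_gt0 : 0 < n by exact: ltn_trans n_gt2.
apply: (not_filled_of_codes n_gt0 e_inj e_onto eM e1 (s := band n)).
- exact: band_codes.
- by rewrite -size_eq0 size_cat addnC.
- exact: band_independent.
- exact: band_saturated.
- exact: band_unfilling.
Qed.
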